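(* Let $V$ and $H$ be complex Hilbert spaces, $j\colon V\to H$ a bounded linear map with dense range, and let $a\colon V\times V\to\mathbb{C}$ be a $j$-elliptic form. Let $H'$ be a subspace of $H$ containing $j(V)$, equipped with its own norm $\|\cdot\|_{H'}$, for which it is a Banach space continuously embedded into $H$. Assume that there exist $\alpha\in[0,1)$ and $M\ge0$ such that $$\|j(u)\|_{H'}\le M\|u\|_V^{\alpha}\|j(u)\|_H^{1-\alpha}\qquad\text{for all }u\in V.$$ Let $b\colon V\times V\to\mathbb{C}$ be a continuous sesquilinear form such that $$\operatorname{Re} b(u,u)\ge -c\,\|u\|_V\|j(u)\|_{H'}\qquad\text{for all }u\in V$$ for some $c\ge0$. Then $a+b\colon V\times V\to\mathbb{C}$ is $j$-elliptic.
   Context: A sesquilinear form $a\colon V\times V\to\mathbb{C}$ is called $j$-elliptic if it is continuous and there exist $\omega\in\mathbb{R}$, $\mu>0$ with $\operatorname{Re} a(u,u)-\omega\|j(u)\|_H^2\ge\mu\|u\|_V^2$ for all $u\in V$. *)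

(* Defs.v *)
From HB Require Import structures.
From mathcomp Require Import all_boot all_order all_algebra.
From mathcomp Require Import complex.
From mathcomp Require Import all_classical all_reals all_analysis.

Set Implicit Arguments.
Unset Strict Implicit.
Unset Printing Implicit Defensive.

Import Order.TTheory GRing.Theory Num.Theory.
Import numFieldNormedType.Exports.

Local Open Scope ring_scope.
Local Open Scope classical_set_scope.

(* Forms are linear in the first argument and conjugate-linear in the second. *)
Notation "{ 'sesquilinear' V }" :=
  {bilinear V%type -> V%type -> _ | *%R & Num.conj \; *%R}
  (format "{ 'sesquilinear'  V }") : ring_scope.

HB.mixin Record CompleteNormedModule_isHilbert (R : realType) V
    of CompleteNormedModule R[i] V := {
  inner : {dot V for Num.conj};
  inner_normE : forall x : V, `|x| ^+ 2 = inner x x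
}.

#[short(type="hilbertType")]
HB.structure Definition Hilbert (R : realType) :=
  {V of CompleteNormedModule R[i] V & CompleteNormedModule_isHilbert R V}.

(* A type T of this kind is a linear subspace {x | P x} of E, embedded by val,
   with a complete norm of its own: nothing relates the norm and the topology
   of T to those that E may carry. *)
#[short(type="subBanachType")]
HB.structure Definition SubBanach (K : numFieldType) (E : lmodType K)
    (P : pred E) :=
  {T of @CompleteNormedModule K T & @GRing.SubLmodule K E P T}.

(* The norm of a normed module over R[i] takes its values in R[i], where it is
   real and nonnegative; rnorm is the same number seen in R. *)
Definition rnorm (R : realType) (V : normedModType R[i]) (x : V) : R :=
  complex.Re `|x|.

(* Joint continuity on V * V; the topology of the scalars is carried by the
   alias (R[i])^o. *)
Definition continuous_form (R : realType) (V : normedModType R[i])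
    (a : {sesquilinear V}) : Prop :=
  continuous (fun p : V * V => a p.1 p.2 : R[i]^o).

Definition j_elliptic (R : realType) (V H : hilbertType R)
    (j : {linear V -> H}) (a : {sesquilinear V}) : Prop :=
  continuous_form a /\
  exists omega mu : R, 0 < mu /\
    forall u : V,
      mu * rnorm u ^+ 2 <= complex.Re (a u u) - omega * rnorm (j u) ^+ 2.

Section AddForm.
Variables (R : realType) (V : lmodType R[i]) (a b : {sesquilinear V}).

Definition add_form (u v : V) : R[i] := a u v + b u v.

Let add_form_bilinear : bilinear_for *%R (Num.conj \; *%R) add_form.
Proof.
split=> [v c x y|u c x y]; rewrite /add_form.
  by rewrite !linearPl /= mulrDr addrACA.
by rewrite !linearPr /= mulrDr addrACA.
Qed.

HB.instance Definition _ :=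
  bilinear_isBilinear.Build R[i] V V R[i] *%R (Num.conj \; *%R) add_form
    add_form_bilinear.

End AddForm.

(* Main.v *)
(* Write x for the norm of u in V and y for the norm of j u in H.  The form b
   costs at most c M x^(1 + alpha) y^(1 - alpha), and since 1 - alpha > 0 this
   is at most (mu / 2) x^2 + K y^2 for K large: half of the coercivity of a
   absorbs the first term, and lowering omega by K absorbs the second. *)

Require Import Defs.
From HB Require Import structures.
From mathcomp Require Import all_boot all_order all_algebra.
From mathcomp Require Import complex.
From mathcomp Require Import all_classical all_reals all_analysis.
From mathcomp Require Import lra.

Set Implicit Arguments.
Unset Strict Implicit.
Unset Printing Implicit Defensive.

Import Order.TTheory GRing.Theory Num.Theory.
Import numFieldNormedType.Exports.

Local Open Scope ring_scope.
Local Open Scope classical_set_scope.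

Lemma rnorm_ge0 (R : realType) (V : normedModType R[i]) (x : V) : 0 <= rnorm x.
Proof. by have := normr_ge0 x; rewrite lecE => /andP[]. Qed.

(** The exponents add up to 1, which is nonzero, so the exponent law holds at [x = 0] too. *)
Lemma powR_split (R : realType) (x alpha : R) :
  0 <= x -> x `^ alpha * x `^ (1 - alpha) = x.
Proof.
by move=> x0; rewrite -powRD addrC subrK ?powRr1 // oner_eq0.
Qed.

(* Case split on [y <= t * x], with t so small that [D * t `^ (1 - alpha) <= eps]. *)
Lemma interp_young (R : realType) (alpha D eps : R) :
    0 <= alpha -> alpha < 1 -> 0 <= D -> 0 < eps ->
  exists K : R, forall x y : R, 0 <= x -> 0 <= y ->
    D * (x * (x `^ alpha * y `^ (1 - alpha))) <= eps * x ^+ 2 + K * y ^+ 2.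
Proof.
move=> alpha0 alpha1 D0 eps0.
have beta0 : 0 < 1 - alpha by rewrite subr_gt0.
have D1 : 0 < D + 1 by rewrite ltr_wpDl.
(* Chosen so that [t] to the power [1 - alpha] is [eps / (D + 1)]; dividing by [D + 1] covers
   [D = 0]. *)
pose t := (eps / (D + 1)) `^ (1 - alpha)^-1.
have t0 : 0 < t by rewrite powR_gt0 ?divr_gt0.
have Dt : D * t `^ (1 - alpha) <= eps.
  rewrite /t -powRrM mulVf ?gt_eqF// powRr1; last by rewrite divr_ge0 ?ltW.
  by rewrite mulrCA ger_pMr// ler_pdivrMr// mul1r lerDl.
have ti0 : 0 <= t^-1 by rewrite invr_ge0 ltW.
exists (D * (t^-1 * t^-1 `^ alpha)) => x y x0 y0.
have [ytx|txy] := leP y (t * x).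
- apply: (@le_trans _ _ (eps * x ^+ 2)); last first.
    by rewrite lerDl mulr_ge0 ?sqr_ge0// !mulr_ge0 ?powR_ge0.
  apply: (@le_trans _ _ (D * t `^ (1 - alpha) * x ^+ 2)); last first.
    by rewrite ler_wpM2r ?sqr_ge0.
  rewrite -mulrA ler_wpM2l// expr2 [leRHS]mulrCA ler_wpM2l//.
  (* Splitting [x] lets its power [alpha] cancel; what remains is [y <= t * x] raised to the power
     [1 - alpha]. *)
  rewrite -[X in _ <= _ * X](powR_split alpha x0) mulrCA ler_wpM2l ?powR_ge0//.
  rewrite -powRM ?(ltW t0)//.
  by rewrite ge0_ler_powR ?nnegrE ?mulr_ge0 ?(ltW beta0) ?(ltW t0).
- apply: (@le_trans _ _ (D * (t^-1 * t^-1 `^ alpha) * y ^+ 2)); last first.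
    by rewrite lerDr mulr_ge0 ?sqr_ge0 ?(ltW eps0).
  have xty : x <= t^-1 * y by rewrite mulrC ler_pdivlMr// mulrC ltW.
  (* Regrouped so that [x <= t^-1 * y] bounds the first factor and its power [alpha] bounds the
     second. *)
  rewrite -mulrA ler_wpM2l// expr2 mulrACA.
  apply: ler_pM => //; first by rewrite mulr_ge0 ?powR_ge0.
  rewrite -[X in _ <= _ * X](powR_split alpha y0) mulrA -powRM//.
  rewrite ler_wpM2r ?powR_ge0//.
  by rewrite ge0_ler_powR ?nnegrE ?mulr_ge0.
Qed.

Lemma continuous_add_form (R : realType) (V : normedModType R[i])
    (a b : {sesquilinear V}) :
  continuous_form a -> continuous_form b -> continuous_form (add_form a b).
Proof. by move=> ca cb p; exact: (@cvgD R[i] R[i]^o _ _ _ _ _ _ _ (ca p) (cb p)). Qed.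

Theorem proposition2p5 (R : realType) (V H : hilbertType R)
    (j : {linear V -> H})
    (j_bounded : exists C : R, forall u : V, rnorm (j u) <= C * rnorm u)
    (j_dense : dense (range j))
    (a : {sesquilinear V}) (a_elliptic : j_elliptic j a)
    (P : pred H) (H' : subBanachType P)
    (H'_embed : continuous (val : H' -> H))
    (jP : forall u : V, P (j u))
    (alpha M : R) (alpha_ge0 : 0 <= alpha) (alpha_lt1 : alpha < 1)
    (M_ge0 : 0 <= M)
    (j_interp : forall u : V,
       rnorm (Sub (j u) (jP u) : H') <=
         M * rnorm u `^ alpha * rnorm (j u) `^ (1 - alpha))
    (b : {sesquilinear V}) (b_cont : continuous_form b)
    (c : R) (c_ge0 : 0 <= c)
    (b_lower : forall u : V,
       - c * rnorm u * rnorm (Sub (j u) (jP u) : H') <= complex.Re (b u u)) :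
  j_elliptic j (add_form a b).
Proof.
have [a_cont [omega [mu [mu0 a_coer]]]] := a_elliptic.
split; first exact: continuous_add_form.
have mu2 : 0 < mu / 2 by rewrite divr_gt0.
(* Here [D] is [c * M] and [eps] is [mu / 2]. *)
have [K HK] := interp_young alpha_ge0 alpha_lt1 (mulr_ge0 c_ge0 M_ge0) mu2.
exists (omega - K), (mu / 2); split=> // u.
rewrite /add_form raddfD /=.
have cu : 0 <= c * rnorm u by rewrite mulr_ge0 ?rnorm_ge0.
have b1 := b_lower u.
have b2 := ler_wpM2l cu (j_interp u).
have b3 := HK _ _ (rnorm_ge0 u) (rnorm_ge0 (j u)).
have a1 := a_coer u.
(* With the products of norms and powers taken as atoms, the goal is the sum of [a1], [b1], [b2] and
   [b3]. *)
lra.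
Qed.
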